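(* Let $(X,f)$ be a dynamical system with $f$ a +proper relation, and let $(\hat X,\hat f)$ be a dynamic compactification of $(X,f)$. If $\hat E\subset|\mathcal G\hat f|$ is a $\mathcal G\hat f\cap\mathcal G\hat f^{-1}$ equivalence class and $E=\hat E\cap X$, then exactly one of the following three possibilities holds: (i) $\hat E$ is a compact subset of $\hat X\setminus X$ and $E=\emptyset$. (ii) $E$ is contained in $|\mathcal Gf|$ and is a noncompact $\mathcal Gf\cap\mathcal Gf^{-1}$ equivalence class whose closure in $\hat X$ meets $\hat X\setminus X$ and is contained in $\hat E$. (iii) $\hat E=E$ is contained in $|\mathcal Gf|$ and is a compact $\mathcal Gf\cap\mathcal Gf^{-1}$ equivalence class. Furthermore, if $x,y\in|\mathcal Gf|$ lie in distinct $\mathcal Gf\cap\mathcal Gf^{-1}$ equivalence classes, then their equivalence classes have disjoint closures in $\hat X$.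
   Context: A space is a locally compact, $\sigma$-compact Hausdorff space. A relation $f$ on $X$ is a subset of $X\times X$; $f(x)=\{y:(x,y)\in f\}$, $f(A)=\bigcup_{x\in A}f(x)$, $f^{-1}=\{(y,x):(x,y)\in f\}$, $|f|=\{x:(x,x)\in f\}$. $f$ is closed if it is a closed subset of $X\times X$; it is +proper if it is closed and $f(A)$ is compact for every compact $A\subset X$. A dynamical system $(X,f)$ is a space $X$ with a closed relation $f$ on $X$. $\mathcal Gf$ is the smallest closed transitive relation on $X$ containing $f$; $\mathcal Gf^{-1}$ denotes $(\mathcal Gf)^{-1}=\mathcal G(f^{-1})$. $\mathcal Gf\cap\mathcal Gf^{-1}$ restricts to an equivalence relation on $|\mathcal Gf|$, and its equivalence classes there are called $\mathcal Gf\cap\mathcal Gf^{-1}$ equivalence classes. A proper compactification of $X$ is a compact Hausdorff space $\hat X$ containing $X$ as a dense (hence, by local compactness, open) topological subspace. The corresponding compactification of $(X,f)$ is $(\hat X,\hat f)$ where $\hat f$ is the closure of $f$ in $\hat X\times\hat X$. It is a dynamic compactification if it is proper and $\mathcal G\hat f\cap(X\times X)=\mathcal Gf$. *)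

(* Defs.v *)
From mathcomp Require Import all_boot all_classical topology.

Set Implicit Arguments.
Unset Strict Implicit.
Unset Printing Implicit Defensive.

Local Open Scope classical_set_scope.

Definition sigma_compact (X : topologicalType) : Prop :=
  exists K : nat -> set X,
    (forall n, compact (K n)) /\ \bigcup_n K n = [set: X].

Definition is_space (X : topologicalType) : Prop :=
  [/\ locally_compact [set: X], sigma_compact X & hausdorff_space X].

Definition relation_image (X : Type) (f : set (X * X)) (A : set X) : set X :=
  \bigcup_(x in A) xsection f x.

(* The set written |f|. *)
Definition cyclic_set (X : Type) (f : set (X * X)) : set X :=
  [set x | f (x, x)].

Definition plus_proper (X : topologicalType) (f : set (X * X)) : Prop :=
  closed f /\ forall A : set X, compact A -> compact (relation_image f A).

Definition dynamical_system (X : topologicalType) (f : set (X * X)) : Prop :=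
  is_space X /\ closed f.

Definition transitive_relation (X : Type) (g : set (X * X)) : Prop :=
  forall x y z, g (x, y) -> g (y, z) -> g (x, z).

(* The relation written G f. [smallest] is an intersection; closedness and
   transitivity are both stable under intersections. *)
Definition Grel (X : topologicalType) (f : set (X * X)) : set (X * X) :=
  smallest [set g : set (X * X) | closed g /\ transitive_relation g] f.

Definition Gclass (X : topologicalType) (f : set (X * X)) (x : X) : set X :=
  [set y | cyclic_set (Grel f) y
           /\ (Grel f `&` ((Grel f)^-1)%relation) (x, y)].

Definition is_Gclass (X : topologicalType) (f : set (X * X)) (E : set X)
    : Prop :=
  exists2 x, cyclic_set (Grel f) x & E = Gclass f x.

(* The inclusion of X in its compactification is an arbitrary topological
   embedding i; a subset B of the compactification meets X in i @^-1` B, and a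
   subset A of X is i @` A when regarded in the compactification. *)
Definition topological_embedding (X Y : topologicalType) (i : X -> Y) : Prop :=
  injective i /\ forall U : set X, open U <-> exists2 V, open V & U = i @^-1` V.

Definition proper_compactification (X Y : topologicalType) (i : X -> Y)
    : Prop :=
  [/\ compact [set: Y], hausdorff_space Y, topological_embedding i
    & dense (range i)].

Definition prod_map (X Y : Type) (i : X -> Y) (p : X * X) : Y * Y :=
  (i p.1, i p.2).

Definition extended_relation (X Y : topologicalType) (i : X -> Y)
    (f : set (X * X)) : set (Y * Y) :=
  closure (prod_map i @` f).

Definition dynamic_compactification (X Y : topologicalType) (i : X -> Y)
    (f : set (X * X)) : Prop :=
  proper_compactification i /\
  prod_map i @^-1` Grel (extended_relation i f) = Grel f.

Definition exactly_one_of_three (P Q R : Prop) : Prop :=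
  (P \/ Q \/ R) /\ ~ (P /\ Q) /\ ~ (P /\ R) /\ ~ (Q /\ R).

(* Main.v *)
Require Import Defs.
From mathcomp Require Import all_boot all_classical topology.

Set Implicit Arguments.
Unset Strict Implicit.
Unset Printing Implicit Defensive.

Local Open Scope classical_set_scope.

(* G fhat is the smallest closed transitive relation containing fhat, so a
   partition of one of its classes into a compact piece E inside X and a piece
   B outside X is refuted by deleting from G fhat an open set of pairs that
   contains E x B but avoids fhat, while preserving transitivity.  A compact
   neighbourhood K of E in X and +properness give open U around E (with trace
   in K) and V around B (the complement of f(K)) such that fhat has no edge
   from U to V.  The pairs (x, z) in U x V that are not joined through a
   third point outside U and V form such a set. *)

Lemma compact_subset_interior (X : topologicalType) (E : set X) :
  locally_compact [set: X] -> compact E ->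
  exists2 K, compact K & E `<=` interior K.
Proof.
move=> lcX /compact_near_coveringP cE.
(* [F] is the filter of properties of sets that hold for every sufficiently large compact [K].
   Near-covering compactness of [E] then turns the local statement, that points near [x] eventually
   lie in [interior K], into a uniform one. *)
pose F : set_system (set X) :=
  [set S | exists2 K0, compact K0 & forall K, compact K -> K0 `<=` K -> S K].
have FF : Filter F.
  split.
  - by exists set0; first exact: compact0.
  - move=> S S' [K0 cK0 h0] [K1 cK1 h1]; exists (K0 `|` K1).
      exact: compactU.
    move=> K cK; rewrite subUset => -[K0K K1K]; split; [exact: h0|exact: h1].
  - by move=> S S' SS' [K0 cK0 h0]; exists K0 => // K cK /(h0 _ cK); apply: SS'.
have [|K0 cK0 h] := cE _ F (fun K x => interior K x) FF; last first.
  by exists K0 => //; exact: h.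
move=> x Ex; have [C nC [cC _]] := lcX x I.
have {}nC : nbhs x C by rewrite withinET in nC.
exists (interior C, [set K | C `<=` K]).
  split; first exact: nbhs_interior.
  by exists C.
move=> [y K] /= [Cy CK]; exact: interiorS Cy.
Qed.

Lemma open_setX (X Y : topologicalType) (A : set X) (B : set Y) :
  open A -> open B -> open (A `*` B).
Proof.
move=> oA oB; rewrite openE => -[x y] [/= Ax By].
by exists (A, B); first by split; exact: open_nbhs_nbhs.
Qed.

(** The complement is the projection, along the compact factor [W], of a closed set of triples; such
    projections are closed. *)
Lemma open_no_intermediate (Y : topologicalType) (g : set (Y * Y))
    (W : set Y) : closed g -> compact W ->
  open [set p : Y * Y | forall w, W w -> ~ (g (p.1, w) /\ g (w, p.2))].
Proof.
move=> cg /compact_near_coveringP cW; rewrite openE => p hp.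
have FF : Filter (nbhs p) := nbhs_filter p.
apply: (cW _ (nbhs p) (fun q w => ~ (g (q.1, w) /\ g (w, q.2))) FF) => w Ww.
have : open (~` [set r : Y * (Y * Y) | g (r.2.1, r.1) /\ g (r.1, r.2.2)]).
  apply: closed_openC; apply: (@closedI _ [set r : Y * (Y * Y) | g (r.2.1, r.1)]
    [set r : Y * (Y * Y) | g (r.1, r.2.2)]).
  - apply: (@preimage_closed _ _ (fun r : Y * (Y * Y) => (r.2.1, r.1))) => // r _.
    apply: cvg_pair => /=; last exact: cvg_fst.
    apply: (@cvg_comp _ _ _ snd fst); [exact: cvg_snd|exact: cvg_fst].
  - apply: (@preimage_closed _ _ (fun r : Y * (Y * Y) => (r.1, r.2.2))) => // r _.
    apply: cvg_pair => /=; first exact: cvg_fst.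
    apply: (@cvg_comp _ _ _ snd snd); [exact: cvg_snd|exact: cvg_snd].
rewrite openE => /(_ (w, p)); apply; exact: hp.
Qed.

Lemma Grel_closed (X : topologicalType) (f : set (X * X)) : closed (Grel f).
Proof. by apply: closed_bigI => g [[]]. Qed.

Lemma Grel_trans (X : topologicalType) (f : set (X * X)) :
  transitive_relation (Grel f).
Proof.
by move=> x y z xy yz g hg; case: (hg) => -[_ tg] _; apply: tg (xy g hg) (yz g hg).
Qed.

Lemma Grel_sub (X : topologicalType) (f : set (X * X)) : f `<=` Grel f.
Proof. exact: sub_gen_smallest. Qed.

Lemma GclassE (X : topologicalType) (f : set (X * X)) (x : X) :
  Gclass f x = [set y | Grel f (x, y) /\ Grel f (y, x)].
Proof.
apply/seteqP; split=> y; first by case.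
by move=> [xy yx]; split; first exact: Grel_trans yx xy.
Qed.

Lemma Gclass_eq (X : topologicalType) (f : set (X * X)) (x y : X) :
  Gclass f x y -> Gclass f x = Gclass f y.
Proof.
rewrite !GclassE => -[xy yx]; apply/seteqP; split=> z [h1 h2]; split.
- exact: Grel_trans yx h1.
- exact: Grel_trans h2 xy.
- exact: Grel_trans xy h1.
- exact: Grel_trans h2 yx.
Qed.

Lemma Gclass_closed (X : topologicalType) (f : set (X * X)) (x : X) :
  closed (Gclass f x).
Proof.
rewrite GclassE; apply: (@closedI _ [set y | Grel f (x, y)]
  [set y | Grel f (y, x)]).
- apply: (@preimage_closed _ _ (fun y => (x, y))); last exact: Grel_closed.
  by move=> y _; apply: cvg_pair; [exact: cvg_cst|exact: cvg_id].
- apply: (@preimage_closed _ _ (fun y => (y, x))); last exact: Grel_closed.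
  by move=> y _; apply: cvg_pair; [exact: cvg_id|exact: cvg_cst].
Qed.

Lemma Gclass_no_split (Y : topologicalType) (f : set (Y * Y)) (x0 : Y)
    (U V : set Y) :
  compact [set: Y] -> open U -> open V -> Gclass f x0 `<=` U `|` V ->
  f `&` (U `*` V) = set0 ->
  (Gclass f x0 `&` U) `*` (Gclass f x0 `&` V) = set0.
Proof.
move=> cY oU oV EUV fUV.
pose W := ~` (U `|` V).
have cW : compact W.
  by apply: subclosed_compact cY _ => //; apply: open_closedC; exact: openU.
pose O := (U `*` V) `&`
  [set p : Y * Y | forall w, W w -> ~ (Grel f (p.1, w) /\ Grel f (w, p.2))].
have oO : open O.
  apply: openI; last by apply: open_no_intermediate => //; exact: Grel_closed.
  exact: open_setX.
have tg : transitive_relation (Grel f `&` ~` O).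
  move=> x y z [xy nxy] [yz nyz]; split; first exact: Grel_trans xy yz.
  move=> [[/= Ux Vz] nW].
  (* A point of [W] joining [y] to [z], or [x] to [y], would also join [x] to [z]. So if [y] is in
     [U] then [(y, z)] is already in [O], and if [y] is in [V] then [(x, y)] is. *)
  have [[Uy|Vy]|Wy] := pselect ((U `|` V) y); last exact: (nW y).
  - apply: nyz; split=> // w Ww [/= yw wz].
    by apply: (nW w Ww); split=> //; exact: Grel_trans xy yw.
  - apply: nxy; split=> // w Ww [/= xw wy].
    by apply: (nW w Ww); split=> //; exact: Grel_trans wy yz.
have sg : Grel f `<=` Grel f `&` ~` O.
  apply: smallest_sub.
    by split=> //; apply: closedI; [exact: Grel_closed|exact: open_closedC].
  move=> p fp; split; first exact: Grel_sub.
  by move=> [pUV _]; rewrite -[False]/(set0 p) -fUV.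
apply/seteqP; split=> // -[x z] [/= [Ex Ux] [Ez Vz]].
move: Ex Ez; rewrite GclassE => -[x0x xx0] [x0z zx0].
(* Anything between two points of the class is again in the class, hence in [U] or [V] and not in
   [W]; thus [(x, z)] would be a deleted pair. *)
have [_] := sg _ (Grel_trans xx0 x0z); apply; split=> // w Ww [/= xw wz].
apply: Ww; apply: EUV; rewrite GclassE; split.
- exact: Grel_trans x0x xw.
- exact: Grel_trans wz zx0.
Qed.

Section Embedding.
Variables (X Y : topologicalType) (i : X -> Y).
Hypothesis ei : topological_embedding i.

Lemma embedding_continuous : continuous i.
Proof. by apply/continuousP => V oV; apply/ei.2; exists V. Qed.

(** A filter on [A] is pushed forward by [i]; a cluster point of the image pulls back because open
    sets of [X] are traces of open sets of [Y]. *)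
Lemma embedding_compact (A : set X) : compact (i @` A) -> compact A.
Proof.
move=> ciA F PF FA.
have FiA : (i @ F) (i @` A) by apply: (@filterS _ F _ A) FA => y Ay; exists y.
have [_ [[x Ax <-] clx]] := ciA (i @ F) _ FiA.
exists x; split=> // B C FB; rewrite nbhsE => -[U [oU Ux] UC].
have [V oV UV] := (ei.2 U).1 oU.
have [||_ [[y By <-] Vy]] := clx (i @` B) V.
- by apply: (@filterS _ F _ B) FB => y By; exists y.
- by apply: open_nbhs_nbhs; split=> //; rewrite UV in Ux.
by exists y; split=> //; apply: UC; rewrite UV.
Qed.

End Embedding.

Lemma Gclass_compact_trace (X Y : topologicalType) (i : X -> Y)
    (f : set (X * X)) (y0 : Y) :
  locally_compact [set: X] -> plus_proper f -> proper_compactification i ->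
  compact (i @^-1` Gclass (extended_relation i f) y0) ->
  i @^-1` Gclass (extended_relation i f) y0 !=set0 ->
  Gclass (extended_relation i f) y0 `<=` range i.
Proof.
move=> lcX [_ fcomp] [cY hY ei _] cE [x Ex].
have [K cK EK] := compact_subset_interior lcX cE.
have [U oU iU] := (ei.2 (interior K)).1 (open_interior K).
pose V := ~` (i @` relation_image f K).
have oV : open V.
  apply: closed_openC; apply: compact_closed => //.
  apply: continuous_compact; last exact: fcomp.
  exact/continuous_subspaceT/embedding_continuous.
have outV y : ~ range i y -> V y by move=> ny [z _ zy]; apply: ny; exists z.
have UV : Gclass (extended_relation i f) y0 `<=` U `|` V.
  move=> y Ey; have [[z _ zy]|/outV] := pselect (range i y); last by right.
  left; rewrite -zy; rewrite -[U _]/((i @^-1` U) z) -iU.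
  by apply: EK; rewrite /preimage /= zy.
(* [U * V] is open, so meeting the closure of [f] means containing an edge [(a, b)] of [f] itself;
   but [a] in [K] puts [b] in [f(K)], outside [V]. *)
have noedge : extended_relation i f `&` (U `*` V) = set0.
  apply/seteqP; split=> // p [clp pUV].
  have [_ [[[a b] fab <-] [/= Ua]]] := clp _ (open_nbhs_nbhs (conj (open_setX oU oV) pUV)).
  apply; exists b => //; exists a; last by apply/xsectionP.
  by apply: interior_subset; rewrite iU.
have split0 := Gclass_no_split cY oU oV UV noedge.
move=> y Ey; apply: contrapT => /outV Vy.
rewrite -[False]/(set0 (i x, y)) -split0; split; split=> //=.
by rewrite -[U _]/((i @^-1` U) x) -iU; exact: EK.
Qed.

Theorem theorem0p1 (X Xhat : topologicalType) (i : X -> Xhat)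
    (f : set (X * X))
    (hXf : dynamical_system f)
    (hf : plus_proper f)
    (hi : dynamic_compactification i f) :
  (forall Ehat : set Xhat,
     is_Gclass (extended_relation i f) Ehat ->
     let E : set X := i @^-1` Ehat in
     exactly_one_of_three
       [/\ compact Ehat, Ehat `<=` ~` range i & E = set0]
       [/\ E `<=` cyclic_set (Grel f),
           is_Gclass f E,
           ~ compact E,
           closure (i @` E) `&` ~` range i !=set0
         & closure (i @` E) `<=` Ehat]
       [/\ Ehat = i @` E,
           E `<=` cyclic_set (Grel f),
           is_Gclass f E
         & compact E])
  /\
  (forall x y : X,
     cyclic_set (Grel f) x -> cyclic_set (Grel f) y ->
     Gclass f x <> Gclass f y ->
     closure (i @` Gclass f x) `&` closure (i @` Gclass f y) = set0).
Proof.
have [[lcX _ _] _] := hXf.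
have [pci GE] := hi; have [cY hY ei _] := pci.
have Gi a b : Grel (extended_relation i f) (i a, i b) <-> Grel f (a, b).
  by rewrite -GE.
(* The dynamic condition enters through [Gi]: classes upstairs of points of [X] trace exactly the
   classes of [X]. *)
have tr x : i @^-1` Gclass (extended_relation i f) (i x) = Gclass f x.
  apply/seteqP; split=> y; rewrite /preimage /= !GclassE.
  - by move=> [/Gi ? /Gi ?].
  - by move=> [? ?]; split; exact/Gi.
have cl x : closure (i @` Gclass f x) `<=` Gclass (extended_relation i f) (i x).
  rewrite closureE; apply: smallest_sub; first exact: Gclass_closed.
  by move=> _ [y + <-]; rewrite -tr.
split=> [_ [y0 cy0 ->] E|x y cx cy]; last first.
  move=> nxy; apply/seteqP; split=> // z [/cl zx /cl zy]; apply: nxy.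
  by rewrite -!tr (Gclass_eq zx) (Gclass_eq zy).
have [E0|/set0P[x Ex]] := eqVneq E set0.
  have nclass : ~ is_Gclass f E.
    move=> [x cx Ef]; have : E x by rewrite Ef GclassE.
    by rewrite E0.
  split; last first.
    split; first by case=> _ [_ /nclass].
    by split; [case=> _ [_ _ /nclass]|case=> -[_ /nclass]].
  left; split=> //.
    by apply: subclosed_compact cY _ => //; exact: Gclass_closed.
  by move=> _ /[swap] -[x _ <-] Ex; rewrite -[False]/(set0 x) -E0.
have EhatE := Gclass_eq Ex.
have EE : E = Gclass f x by rewrite /E EhatE tr.
have Ecyc : E `<=` cyclic_set (Grel f) by rewrite EE => y [].
have cx : cyclic_set (Grel f) x by exact: Ecyc.
have Ecl : is_Gclass f E by exists x.
have nE0 : E <> set0 by move=> E0; rewrite -[False]/(set0 x) -E0.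
(* Nonemptiness of [E] excludes (i), and compactness of [E] separates (iii) from (ii). *)
split; last first.
  split; first by case=> -[_ _ /nE0].
  by split; [case=> -[_ _ /nE0]|case=> -[_ _ + _ _] [_ _ _ cE]; apply].
have [cE|ncE] := pselect (compact E).
  right; right; split=> //; apply/seteqP; split; last by move=> _ [z Ez <-].
  have sub := Gclass_compact_trace lcX hf pci cE (ex_intro _ x Ex).
  by move=> y Ey; have [z _ zy] := sub _ Ey; exists z; rewrite // /E /preimage /= zy.
right; left; split=> //; last by rewrite EE EhatE; exact: cl.
(* If the closure of [E] stayed inside [X], it would lie in the trace of the class, which is [E]; so
   [i(E)] would be closed in a compact space. *)
apply: contrapT => out; apply: ncE; apply: (embedding_compact ei).
suff -> : i @` E = closure (i @` E).
  by apply: subclosed_compact cY _ => //; exact: closed_closure.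
apply/seteqP; split; first exact: subset_closure.
move=> y cly; have [[z _ zy]|ny] := pselect (range i y); last first.
  by case: out; exists y.
exists z => //; rewrite EE -tr /preimage /= zy; apply: cl; by rewrite -EE.
Qed.
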